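(* If $n\ge 5$ is an integer, then the crown graph $H_{n,n}$ is $\lceil n/2 \rceil$-representable, i.e. there exists a word that $\lceil n/2\rceil$-represents $H_{n,n}$.
   Context: The crown graph $H_{n,n}$ is the simple graph with vertex set $\{1,\ldots,n,1',\ldots,n'\}$ ($2n$ distinct vertices) and edge set $\{ij' : 1\le i,j\le n,\ i\neq j\}$; that is, the complete bipartite graph $K_{n,n}$ with a perfect matching removed. Two distinct letters $x,y$ alternate in a word $w$ if, after deleting all letters other than $x$ and $y$ from $w$, no two consecutive letters of the resulting word are equal. For a positive integer $k$, a word $w$ over the alphabet $V$ $k$-represents a simple graph $G=(V,E)$ if each letter of $V$ occurs exactly $k$ times in $w$ and, for all distinct $x,y\in V$, the letters $x$ and $y$ alternate in $w$ if and only if $xy\in E$. A graph is $k$-representable (also called $k$-word-representable) if some word $k$-represents it. *)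

(* Defs.v *)
From mathcomp Require Import all_boot.
Set Implicit Arguments.
Unset Strict Implicit.
Unset Printing Implicit Defensive.

Record sgraph := SGraph {
  vertex :> finType;
  edge : rel vertex;
  edge_sym : symmetric edge;
  edge_irr : irreflexive edge
}.

Definition alternate (T : eqType) (w : seq T) (x y : T) : bool :=
  sorted (fun a b => a != b) [seq z <- w | (z == x) || (z == y)].

Definition k_represents (k : nat) (G : sgraph) (w : seq G) : Prop :=
  (forall x : G, count_mem x w = k) /\
  (forall x y : G, x != y -> alternate w x y <-> edge x y).

Definition k_representable (k : nat) (G : sgraph) : Prop :=
  0 < k /\ exists w : seq G, k_represents k w.

(* The vertices i and i' are [inl i] and [inr i], numbered from 0. *)
Definition crown_edge (n : nat) : rel ('I_n + 'I_n) := fun u v =>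
  match u, v with
  | inl i, inr j => i != j
  | inr i, inl j => i != j
  | _, _ => false
  end.

Lemma crown_edge_sym (n : nat) : symmetric (@crown_edge n).
Proof. by move=> [i|i] [j|j] //=; rewrite eq_sym. Qed.

Lemma crown_edge_irr (n : nat) : irreflexive (@crown_edge n).
Proof. by case. Qed.

Definition crown (n : nat) : sgraph :=
  SGraph (@crown_edge_sym n) (@crown_edge_irr n).

(* Main.v *)
Require Import Defs.
From mathcomp Require Import all_boot.
From mathcomp Require Import zify.

Set Implicit Arguments.
Unset Strict Implicit.
Unset Printing Implicit Defensive.

(* Let k be the ceiling of n / 2 and start from k blocks A_p B_p, where A_p
   (resp. B_p) is a permutation of the unprimed (resp. primed) letters; every
   unprimed letter alternates with every primed one. Let A_p end and B_p start
   with the copies of one letter l_p = p, and let B_p end and A_(p+1) start with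
   the copies of another letter g_p = k + p, the indices p being cyclic. Swapping
   the two adjacent copies of a letter at each of these 2k boundaries destroys
   the alternation of i and i' and of nothing else. Inside the blocks the letters
   are ordered so that no two letters on the same side alternate: A_p has the
   other l's before the other g's, and B_p the other way round.
   Non-alternation of x and y is detected by two prefixes of the word between
   which the number of x's minus the number of y's varies by at least 2. *)

(** * Alternation and letter counts in prefixes *)

Section Alternation.
Variable T : eqType.
Implicit Types (x y : T) (u v w s : seq T).

(** Here [y] is the letter preceding [s], so a nonempty [s] starts with [x]; the induction exchanges
    the two letters. *)
Lemma path_neq_count x y s : x != y -> all (pred2 x y) s ->
    path (fun a b => a != b) y s ->
  count_mem y s <= count_mem x s <= (count_mem y s).+1.
Proof.
elim: s x y => //= z s IHs x y neq_xy /andP[/orP[]/eqP-> all_s] /andP[neq_z path_s].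
- have all_s' : all (pred2 y x) s.
    by apply: sub_all all_s => t /=; rewrite orbC.
  have := IHs y x neq_z all_s' path_s.
  by rewrite eqxx (negPf neq_xy); lia.
- by rewrite eqxx in neq_z.
Qed.

Lemma alternate_sym w x y : alternate w x y = alternate w y x.
Proof. by rewrite /alternate; congr sorted; apply: eq_filter => z; rewrite orbC. Qed.

Lemma alternate_prefix_count w x y : x != y -> alternate w x y ->
    (forall u, prefix u w -> count_mem y u <= count_mem x u <= (count_mem y u).+1)
  \/ (forall u, prefix u w -> count_mem x u <= count_mem y u <= (count_mem x u).+1).
Proof.
move=> neq_xy; rewrite /alternate.
set f := fun z => (z == x) || (z == y).
have count_f u z : f z -> count_mem z u = count_mem z (filter f u).
  move=> fz; rewrite count_filter; apply: eq_count => t /=.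
  by case: eqP => // ->; rewrite fz.
have allf u : all (pred2 x y) (filter f u) by apply: filter_all.
have allf' u : all (pred2 y x) (filter f u).
  by apply: sub_all (allf u) => t /=; rewrite orbC.
have fx : f x by rewrite /f eqxx.
have fy : f y by rewrite /f eqxx orbT.
have main z : path (fun a b => a != b) z (filter f w) -> forall u, prefix u w ->
    path (fun a b => a != b) z (filter f u).
  move=> path_w u /prefixP[v def_w]; move: path_w.
  by rewrite def_w filter_cat cat_path => /andP[].
case E: (filter f w) => [|z s] /=.
  move=> _; left=> u pre_u; rewrite (count_f u x) // (count_f u y) //.
  by apply: path_neq_count (allf u) (main y _ u pre_u); rewrite ?E.
move=> path_s; have: z \in filter f w by rewrite E mem_head.
rewrite mem_filter => /andP[/orP[]/eqP eq_z _]; [left|right] => u pre_u;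
  rewrite (count_f u x) // (count_f u y) //; subst z.
- apply: path_neq_count (allf u) (main y _ u pre_u) => //.
  by rewrite E /= eq_sym neq_xy.
- apply: path_neq_count (allf' u) (main x _ u pre_u) => //; first by rewrite eq_sym.
  by rewrite E /= neq_xy.
Qed.

(** If [x] and [y] alternate, the difference of their counts stays in {0, 1} or in {-1, 0},
    according to which comes first. *)
Lemma prefix_count_nalternate w u v x y : x != y -> prefix u w -> prefix v w ->
    count_mem x v + count_mem y u + 1 < count_mem x u + count_mem y v ->
  ~~ alternate w x y.
Proof.
move=> neq_xy pre_u pre_v lt_uv; apply/negP => /(alternate_prefix_count neq_xy).
by case=> H; move: (H u pre_u) (H v pre_v); lia.
Qed.

(** When [p j] fails, the [x] of block [j] has moved back to the end of the preceding block, which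
    then ends with [x] instead of [y]; hence the start letter. *)
Lemma path_alternating_blocks x y (p : nat -> bool) i m : x != y ->
  path (fun a b => a != b) (if p i then y else x)
    (flatten [seq nseq (p j) x ++ y :: nseq (~~ p j.+1) x | j <- iota i m]).
Proof.
move=> neq_xy; have neq_yx : y != x by rewrite eq_sym.
elim: m i => //= m /(_ _.+1) IHm i; move: (IHm i).
by case: (p i); case: (p i.+1); rewrite /= ?neq_xy ?neq_yx.
Qed.

End Alternation.

(** * Construction of the word *)

Section CrownWord.
Variables n k : nat.
Hypotheses (k_ge3 : 2 < k) (le_n_2k : n <= k.*2).
Local Notation V := ('I_n + 'I_n)%type.
Implicit Types (a b : 'I_n) (r : nat).

(** Selecting by a predicate on [nat] makes the piece of a missing index empty: for [n = k.*2.-1]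
    there is no letter g_(k-1). *)
Definition ords (P : pred nat) : seq 'I_n := [seq i <- enum 'I_n | P (val i)].

(* The index of the g-letter shared by blocks r - 1 and r; its unprimed copy,
   moved across the boundary, occurs twice in block r - 1 and not in block r. *)
Definition cyc_pred r := if r is r'.+1 then k + r' else k.*2.-1.

Lemma cyc_predE r :
  r = 0 /\ cyc_pred r = k.*2.-1 \/ 0 < r /\ cyc_pred r = k + r.-1.
Proof. by case: r => [|r]; [left | right]. Qed.

(* The cyclic word is cut just before A_0 (minus g_(k-1)), so block r ends with
   the swapped pair g_r, g_r'. *)
Definition pieces r : seq (seq V) :=
  [:: map inl (ords (fun i => (i < k) && (i != r)));
      map inl (ords (fun i => (k <= i) && (i != cyc_pred r)));
      map inr (ords (pred1 r));
      map inl (ords (pred1 r));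
      map inr (ords (fun i => (k <= i) && (i != k + r)));
      map inr (ords (fun i => (i < k) && (i != r)));
      map inl (ords (pred1 (k + r)));
      map inr (ords (pred1 (k + r)))].

Definition blocks m : seq V := flatten [seq flatten (pieces r) | r <- iota 0 m].

Definition crown_word := blocks k.

Definition cut r j := blocks r ++ flatten (take j (pieces r)).

Lemma blocksS m : blocks m.+1 = blocks m ++ flatten (pieces m).
Proof. by rewrite /blocks -addn1 iotaD map_cat flatten_cat /= cats0. Qed.

Lemma prefix_cut r j : r < k -> prefix (cut r j) crown_word.
Proof.
move=> lt_rk; rewrite /crown_word -(subnKC lt_rk) /blocks iotaD map_cat flatten_cat.
rewrite -/(blocks r.+1) blocksS -{1}(cat_take_drop j (pieces r)) flatten_cat.
by rewrite -!catA catA prefix_prefix.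
Qed.

(** * Letter counts over whole blocks *)

Lemma filter_ords P a : [seq i <- ords P | i == a] = nseq (P a) a.
Proof.
rewrite /ords -filter_predI.
rewrite (eq_filter (a2 := predI (fun _ => P a) (pred1 a))); last first.
  by move=> i /=; case: eqP => [->|]; rewrite ?andbT ?andbF.
rewrite filter_predI filter_pred1_uniq ?enum_uniq ?mem_enum //=.
by case: (P a).
Qed.

Lemma count_ords P a : count_mem a (ords P) = P a.
Proof. by rewrite -size_filter filter_ords size_nseq. Qed.

Lemma count_inl_inl P a : count_mem (inl a : V) (map inl (ords P)) = P a.
Proof. by rewrite count_map -count_ords; apply: eq_count. Qed.

Lemma count_inr_inr P a : count_mem (inr a : V) (map inr (ords P)) = P a.
Proof. by rewrite count_map -count_ords; apply: eq_count. Qed.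

Lemma count_inl_inr P a : count_mem (inl a : V) (map inr (ords P)) = 0.
Proof. by rewrite count_map (eq_count (a2 := pred0)) ?count_pred0. Qed.

Lemma count_inr_inl P a : count_mem (inr a : V) (map inl (ords P)) = 0.
Proof. by rewrite count_map (eq_count (a2 := pred0)) ?count_pred0. Qed.

Definition count_ordsE :=
  (count_inl_inl, count_inr_inr, count_inl_inr, count_inr_inl).

(** The last g-letter lacks its first copy because of the cyclic cut, and g_(m-1) is one ahead after
    block [m - 1]. At [m = 0] and [m = k] the two corrections cancel. *)
Lemma count_blocks_inl m a : m <= k ->
  count_mem (inl a) (blocks m) + (a == cyc_pred 0 :> nat)
    = m + (a == cyc_pred m :> nat).
Proof.
elim: m => [|m IHm] lt_mk //; move: {IHm}(IHm (ltnW lt_mk)).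
rewrite blocksS count_cat /= cats0 !count_cat !count_ordsE /=.
by case: m lt_mk => [|m] /=; have := ltn_ord a; lia.
Qed.

Lemma count_blocks_inr m a : m <= k -> count_mem (inr a) (blocks m) = m.
Proof.
elim: m => [|m IHm] lt_mk //; move: {IHm}(IHm (ltnW lt_mk)).
by rewrite blocksS count_cat /= cats0 !count_cat !count_ordsE /=; lia.
Qed.

Lemma count_crown_word (x : V) : count_mem x crown_word = k.
Proof.
case: x => a; last exact: count_blocks_inr.
have cyc_pred_k : cyc_pred k = cyc_pred 0.
  by have := cyc_predE k; rewrite /=; lia.
by have := count_blocks_inl a (leqnn k); rewrite cyc_pred_k => /addIn.
Qed.

(** * Edges: alternating pairs *)

(** A swap only exchanges copies of some [i] and its own partner, so it leaves the order of [inl a]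
    and [inr b] unchanged. *)
Lemma alternate_crown_word_edge a b : a != b ->
  alternate crown_word (inl a) (inr b).
Proof.
move=> neq_ab; rewrite /alternate /crown_word /blocks.
set x : V := inl a; set y : V := inr b; set f := fun z => (z == x) || _.
have fl P : filter f (map inl (ords P)) = nseq (P a) x.
  rewrite filter_map -map_nseq -filter_ords; congr map.
  by apply: eq_filter => i; rewrite /f /= orbF.
have fr P : filter f (map inr (ords P)) = nseq (P b) y.
  by rewrite filter_map -map_nseq -filter_ords; congr map.
pose p r := a != cyc_pred r :> nat.
have -> : [seq z <- flatten [seq flatten (pieces r) | r <- iota 0 k] | f z]
    = flatten [seq nseq (p j) x ++ y :: nseq (~~ p j.+1) x | j <- iota 0 k].
  rewrite filter_flatten -map_comp; congr flatten; apply/eq_in_map => r.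
  rewrite mem_iota /= add0n => lt_rk; rewrite cats0 !filter_cat !fl !fr /p /=.
  have neq_ab' : (a : nat) <> b by move/val_inj/eqP; rewrite (negPf neq_ab).
  have [cyc_ge cyc_ne] : k <= cyc_pred r /\ cyc_pred r <> k + r.
    by have := cyc_predE r; lia.
  have := ltn_ord b; move: (cyc_pred r) cyc_ge cyc_ne => c cyc_ge cyc_ne lt_bn.
  case: (ltnP a k) => ak; case: (ltnP b k) => bk;
  case: (eqVneq (a : nat) r) => ar; case: (eqVneq (b : nat) r) => br;
  case: (eqVneq (a : nat) c) => ac; case: (eqVneq (a : nat) (k + r)) => akr;
  case: (eqVneq (b : nat) (k + r)) => bkr //=; lia.
have := path_alternating_blocks p 0 k (isT : x != y).
exact: path_sorted.
Qed.

(** * Non-edges: pairs separated by two prefixes *)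

Lemma nalternate_cut (x y : V) r i s j : x != y -> r < k -> s < k ->
    count_mem x (cut s j) + count_mem y (cut r i) + 1
      < count_mem x (cut r i) + count_mem y (cut s j) ->
  ~~ alternate crown_word x y.
Proof.
by move=> neq_xy lt_r lt_s; apply: prefix_count_nalternate; rewrite ?prefix_cut.
Qed.

Lemma cyc_predP a : k <= a -> exists2 s, s < k & a = k + s :> nat.
Proof. by move=> le_ka; exists (a - k); have := ltn_ord a; lia. Qed.

(** One of 0, 1, 2 avoids both values, and [2 < k]. *)
Lemma exists_ltn_avoid2 s t : exists r, [/\ r < k, r != s & r != t].
Proof.
case: (boolP ((0 != s) && (0 != t))) => [/andP[]|H0].
  by exists 0; split=> //; lia.
case: (boolP ((1 != s) && (1 != t))) => [/andP[]|H1].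
  by exists 1; split=> //; lia.
by exists 2; split=> //; lia.
Qed.

Lemma count_cut_inl r j a : r < k ->
  count_mem (inl a) (cut r j) + (a == k.*2.-1 :> nat)
    = r + (a == cyc_pred r :> nat) + count_mem (inl a) (flatten (take j (pieces r))).
Proof.
move=> lt_rk; rewrite /cut count_cat.
by have /= := count_blocks_inl a (ltnW lt_rk); lia.
Qed.

Lemma count_cut_inr r j a : r < k ->
  count_mem (inr a) (cut r j) = r + count_mem (inr a) (flatten (take j (pieces r))).
Proof. by move=> lt_rk; rewrite /cut count_cat count_blocks_inr // ltnW. Qed.

(** The l-letters are swapped inside a block, so none crosses a block boundary. *)
Lemma count_cut_low r j a : r < k -> a < k ->
  count_mem (inl a) (cut r j) = r + count_mem (inl a) (flatten (take j (pieces r))).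
Proof.
move=> lt_rk lt_ak; have := count_cut_inl j a lt_rk.
have -> : (a == k.*2.-1 :> nat) = false by lia.
have -> : (a == cyc_pred r :> nat) = false by have := cyc_predE r; lia.
by rewrite !addn0.
Qed.

Lemma count_cut_low1 r a : r < k -> a < k ->
  count_mem (inl a) (cut r 1) = r + (a != r :> nat).
Proof.
by move=> lt_rk lt_ak; rewrite count_cut_low //= cats0 count_ordsE lt_ak.
Qed.

Lemma cut8 r : cut r 8 = blocks r.+1.
Proof. by rewrite blocksS. Qed.

Lemma count_cut_low8 r a : r < k -> a < k ->
  count_mem (inl a) (cut r 8) = r.+1.
Proof.
move=> lt_rk lt_ak; have := count_blocks_inl a lt_rk; rewrite cut8 /=.
have -> : (a == k.*2.-1 :> nat) = false by lia.
have -> : (a == k + r :> nat) = false by lia.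
by rewrite !addn0.
Qed.

Lemma count_cut_high8 r a s : r < k -> a = k + s :> nat ->
  count_mem (inl a) (cut r 8) + (s.+1 == k) = r.+1 + (s == r).
Proof.
move=> lt_rk eq_a; have := count_blocks_inl a lt_rk; rewrite cut8 /=.
have -> : (a == k.*2.-1 :> nat) = (s.+1 == k) by lia.
by have -> : (a == k + r :> nat) = (s == r) by lia.
Qed.

(** The two side conditions say that [a] is not [cyc_pred r]; the second is the cyclic
    wrap-around. *)
Lemma count_cut_high r j a s : r < k -> a = k + s :> nat -> s.+1 != r ->
    (r == 0) && (s.+1 == k) = false ->
  count_mem (inl a) (cut r j) + (s.+1 == k)
    = r + count_mem (inl a) (flatten (take j (pieces r))).
Proof.
move=> lt_rk eq_a neq_sr neq_s0; have := count_cut_inl j a lt_rk.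
have -> : (a == k.*2.-1 :> nat) = (s.+1 == k) by lia.
have -> : (a == cyc_pred r :> nat) = false by have := cyc_predE r; lia.
by rewrite addn0.
Qed.

Lemma nalternate_inl_inr a : ~~ alternate crown_word (inl a) (inr a).
Proof.
case: (ltnP a k) => [lt_ak|le_ka].
(* The unprimed copy comes first in block [r], the primed one in block [a]. *)
- have [r [lt_rk neq_ra _]] := exists_ltn_avoid2 a a.
  apply: (@nalternate_cut _ _ r 2 a 3) => //.
  rewrite !count_cut_low // !count_cut_inr //= !cats0 !count_cat !count_ordsE /=.
  by rewrite lt_ak [k <= a]leqNgt lt_ak eqxx [_ == r]eq_sym neq_ra /=; lia.
have [s lt_sk eq_a] := cyc_predP le_ka.
(* Block [s] has two copies of [inl a] before its [inr a]. *)
apply: (@nalternate_cut _ _ s 7 s 0) => //.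
rewrite !count_cut_inr //.
have neq_s0 : (s == 0) && (s.+1 == k) = false by lia.
have neq_s : s.+1 != s by lia.
have := count_cut_high 7 lt_sk eq_a neq_s neq_s0.
have := count_cut_high 0 lt_sk eq_a neq_s neq_s0.
rewrite /= !cats0 !count_cat !count_ordsE /= le_ka [a < k]ltnNge le_ka eq_a eqxx /=.
have -> : (k + s == s) = false by lia.
have -> : (k + s == cyc_pred s) = false by have := cyc_predE s; lia.
by rewrite /=; lia.
Qed.

Lemma nalternate_inl_inl a b : a != b -> ~~ alternate crown_word (inl a) (inl b).
Proof.
wlog le_ab : a b / a <= b.
  move=> H; case: (leqP a b) => [|/ltnW le_ba neq_ab]; first exact: H.
  by rewrite alternate_sym; apply: H; rewrite // eq_sym.
move=> neq_ab; have {le_ab} lt_ab : a < b by rewrite ltn_neqAle le_ab andbT.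
have neq_V : inl a != inl b :> V by [].
case: (ltnP b k) => [lt_bk|le_kb].
- have lt_ak := ltn_trans lt_ab lt_bk.
  (* The first piece of block [r] has every l-letter but [r]. *)
  apply: (@nalternate_cut _ _ b 1 a 1) => //.
  by rewrite !count_cut_low1 //; lia.
have [t lt_tk eq_b] := cyc_predP le_kb.
case: (ltnP a k) => [lt_ak|/cyc_predP[s lt_sk eq_a]].
(* After block [t] the letter [b] has gained its moved copy. Avoiding [a] and the cyclic successor
   of [t] makes [a] precede [b] in block [r], with no moved copy of [b] counted. *)
- have [r [lt_rk neq_ra neq_rt]] :=
    exists_ltn_avoid2 a (if t.+1 == k then 0 else t.+1).
  rewrite alternate_sym.
  apply: (@nalternate_cut _ _ t 8 r 1) => //; first by rewrite eq_sym.
  have [neq_tr neq_r0] : t.+1 != r /\ (r == 0) && (t.+1 == k) = false.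
    by move: neq_rt; case: (eqVneq t.+1 k); lia.
  rewrite (count_cut_low8 lt_tk lt_ak) (count_cut_low1 lt_rk lt_ak).
  have := count_cut_high8 lt_tk eq_b.
  have := count_cut_high 1 lt_rk eq_b neq_tr neq_r0.
  by rewrite /= cats0 count_ordsE /= [b < k]ltnNge le_kb !eqxx [nat_of_ord a == r]eq_sym neq_ra /=; lia.
(* The extra copy is that of [a] after block [s], that of [b] after block [t]. *)
- apply: (@nalternate_cut _ _ s 8 t 8) => //.
  have := count_cut_high8 lt_tk eq_a; have := count_cut_high8 lt_tk eq_b.
  have := count_cut_high8 lt_sk eq_a; have := count_cut_high8 lt_sk eq_b.
  by rewrite !eqxx; lia.
Qed.

Lemma count_cut_inr3 r a : r < k ->
  count_mem (inr a) (cut r 3) = r + (a == r :> nat).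
Proof.
by move=> lt_rk; rewrite count_cut_inr //= cats0 !count_cat !count_ordsE.
Qed.

Lemma count_cut_inr5 r a s : r < k -> s < k -> a = k + s :> nat ->
  count_mem (inr a) (cut r 5) = r + (s != r).
Proof.
move=> lt_rk lt_sk eq_a; rewrite count_cut_inr //= cats0 !count_cat !count_ordsE /=.
have -> : (a == r :> nat) = false by lia.
have -> : k <= a by lia.
by have -> : (a == k + r :> nat) = (s == r) by lia.
Qed.

Lemma nalternate_inr_inr a b : a != b -> ~~ alternate crown_word (inr a) (inr b).
Proof.
wlog le_ab : a b / a <= b.
  move=> H; case: (leqP a b) => [|/ltnW le_ba neq_ab]; first exact: H.
  by rewrite alternate_sym; apply: H; rewrite // eq_sym.
move=> neq_ab; have {le_ab} lt_ab : a < b by rewrite ltn_neqAle le_ab andbT.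
have neq_V : inr a != inr b :> V by [].
case: (ltnP b k) => [lt_bk|/cyc_predP[t lt_tk eq_b]].
- have lt_ak := ltn_trans lt_ab lt_bk.
  apply: (@nalternate_cut _ _ a 3 b 3) => //.
  by rewrite !count_cut_inr3 // !eqxx (gtn_eqF lt_ab) (ltn_eqF lt_ab) /=; lia.
case: (ltnP a k) => [lt_ak|/cyc_predP[s lt_sk eq_a]].
(* In block [a] the letter [inr a] leads the primed ones; in block [r] the fifth piece has [inr b],
   as [r != t], before [inr a]. *)
- have [r [lt_rk neq_ra neq_rt]] := exists_ltn_avoid2 a t.
  apply: (@nalternate_cut _ _ a 3 r 5) => //.
  rewrite !count_cut_inr3 // (count_cut_inr5 lt_rk lt_tk eq_b) eqxx (gtn_eqF lt_ab).
  rewrite eq_sym neq_rt count_cut_inr //= cats0 !count_cat !count_ordsE /=.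
  by rewrite [a == r :> nat]eq_sym (negPf neq_ra) [k <= a]leqNgt lt_ak /=; lia.
(* The fifth piece of block [r] lacks just the g-letter [k + r]. *)
- apply: (@nalternate_cut _ _ t 5 s 5) => //.
  rewrite (count_cut_inr5 lt_tk lt_sk eq_a) (count_cut_inr5 lt_tk lt_tk eq_b).
  rewrite (count_cut_inr5 lt_sk lt_sk eq_a) (count_cut_inr5 lt_sk lt_tk eq_b).
  have lt_st : s < t by lia.
  by rewrite !eqxx (gtn_eqF lt_st) (ltn_eqF lt_st) /=; lia.
Qed.

End CrownWord.

(* [uphalf n] is the ceiling of n / 2. *)
Theorem theorem7 (n : nat) (hn : 5 <= n) : k_representable (uphalf n) (crown n).
Proof.
have k_ge3 : 2 < uphalf n by lia.
have le_n_2k : n <= (uphalf n).*2 by lia.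
split; first by lia.
exists (crown_word n (uphalf n)); split; first exact: count_crown_word.
have nalt (A B : bool) : ~~ A -> B = false -> A <-> B.
  by move=> /negPf-> ->.
move=> [a|a] [b|b] neq_xy /=.
- by apply: nalt => //; apply: nalternate_inl_inl.
- case: (eqVneq a b) => [<-|neq_ab].
    by apply: nalt => //; apply: nalternate_inl_inr.
  by split=> // _; apply: alternate_crown_word_edge.
- rewrite alternate_sym eq_sym.
  case: (eqVneq b a) => [<-|neq_ab].
    by apply: nalt => //; apply: nalternate_inl_inr.
  by split=> // _; apply: alternate_crown_word_edge.
- by apply: nalt => //; apply: nalternate_inr_inr.
Qed.
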